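(* Let $a$ be a real number with $a\ne 0$ and let $n$ be a positive integer. Then $$\sum_{k=1}^n\binom{2n}{2k}4^{2k}E_{2n-2k,a}=\frac{2(3^{2n}-1)}{a}+\frac{8(a-1)^2}{a^3}+\frac{2^{2n+2}(a-1)}{a^2}-\frac{8(a-1)^2(2a-1)}{a^4}E_{2n,a}.$$
   Context: For a real number $a$, the sequence $\{E_{n,a}\}$ is defined by $E_{0,a}=1$ and $E_{n,a}=-a\sum_{k=1}^{\lfloor n/2\rfloor}\binom{n}{2k}E_{n-2k,a}$ for $n\ge 1$. *)

(* Defs.v *)
From mathcomp Require Import all_boot all_order all_algebra.
From mathcomp Require Import reals.

Set Implicit Arguments.
Unset Strict Implicit.
Unset Printing Implicit Defensive.

Import GRing.Theory.
Local Open Scope ring_scope.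

(* The recursion for E_{n,a} is course-of-values, so the whole list
   [:: E_{0,a}; ...; E_{n,a}] is built; EnumS below recovers the recursion. *)
Fixpoint Eseq (R : realType) (a : R) (n : nat) : seq R :=
  if n is m.+1 then
    let s := Eseq a m in
    rcons s (- a * \sum_(1 <= k < (n./2).+1) 'C(n, 2 * k)%:R * s`_(n - 2 * k))
  else [:: 1].

Definition Enum (R : realType) (a : R) (n : nat) : R := (Eseq a n)`_n.

Lemma size_Eseq (R : realType) (a : R) (n : nat) : size (Eseq a n) = n.+1.
Proof. by elim: n => //= n IHn; rewrite size_rcons IHn. Qed.

Lemma nth_Eseq (R : realType) (a : R) (n i : nat) :
  (i <= n)%N -> (Eseq a n)`_i = Enum a i.
Proof.
elim: n => [|n IHn]; first by rewrite leqn0 => /eqP ->.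
rewrite leq_eqVlt => /predU1P[-> //|lt_in].
by rewrite /= nth_rcons size_Eseq lt_in IHn.
Qed.

Lemma Enum0 (R : realType) (a : R) : Enum a 0 = 1.
Proof. by []. Qed.

Lemma EnumS (R : realType) (a : R) (n : nat) : (0 < n)%N ->
  Enum a n =
    - a * \sum_(1 <= k < (n./2).+1) 'C(n, 2 * k)%:R * Enum a (n - 2 * k).
Proof.
case: n => // n _; rewrite {1}/Enum [Eseq a n.+1]/=.
rewrite nth_rcons size_Eseq ltnn eqxx; congr (_ * _).
apply: eq_big_nat => k /andP[k_gt0 _]; rewrite nth_Eseq //.
by rewrite -(prednK k_gt0) mulnS addSn subSS leq_subr.
Qed.

(* Main.v *)
Require Import Defs.
From HB Require Import structures.
From mathcomp Require Import all_boot all_order all_algebra.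
From mathcomp Require Import reals.
From mathcomp Require Import ring.

(** Let [L] be the linear functional on polynomials with [L X^i = E_{i,a}].  The
recursion for [E] says that [(1-a) L p + a/2 (L p(X+1) + L p(X-1)) = p(0)], first for
monomials and then for all [p].  Taking [p = ((X+y)^m + (X-y)^m)/2] with [m = 2n], the
numbers [S y = sum_k C(m,2k) y^(2k) E_{m-2k,a}] satisfy
[(1-a) S y + a/2 (S (y+1) + S (y-1)) = y^m]; for [y = 0,1,2,3] this determines
[S 4] in terms of [S 0 = E_{2n,a}]. *)

Import GRing.Theory.
Local Open Scope ring_scope.

Definition umbral {R : nzRingType} (e : nat -> R) (p : {poly R}) : R :=
  \sum_(i < size p) p`_i * e i.

Lemma umbral_wide {R : nzRingType} (e : nat -> R) (n : nat) (p : {poly R}) :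
  (size p <= n)%N -> umbral e p = \sum_(i < n) p`_i * e i.
Proof.
move=> le_pn; rewrite /umbral (big_ord_widen n (fun i => p`_i * e i)) //.
rewrite big_mkcond; apply: eq_bigr => i _; case: ltnP => // le_pi.
by rewrite nth_default // mul0r.
Qed.

Lemma umbral_is_linear {R : nzRingType} (e : nat -> R) :
  linear_for *%R (umbral e).
Proof.
move=> c p q; set n := maxn (size p) (size q).
have le_pn : (size p <= n)%N by apply: leq_maxl.
have le_qn : (size q <= n)%N by apply: leq_maxr.
have le_cn : (size (c *: p + q)%R <= n)%N.
  apply: leq_trans (size_polyD _ _) _; rewrite geq_max le_qn andbT.
  exact: leq_trans (size_scale_leq _ _) le_pn.
rewrite !(umbral_wide e n) // mulr_sumr -big_split; apply: eq_bigr => i _ /=.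
by rewrite coefD coefZ mulrDl mulrA.
Qed.

HB.instance Definition _ (R : nzRingType) (e : nat -> R) :=
  GRing.isLinear.Build R {poly R} R *%R (umbral e) (umbral_is_linear e).

Lemma umbralXn {R : nzRingType} (e : nat -> R) (m : nat) : umbral e 'X^m = e m.
Proof.
rewrite /umbral size_polyXn (bigD1 ord_max) //= coefXn eqxx mul1r big1 ?addr0 //.
move=> i; rewrite -val_eqE /= => /negPf ne_im.
by rewrite coefXn ne_im mul0r.
Qed.

(** Raising [m] by one adds a term on both sides exactly when [m] is odd. *)
Lemma sum_even_nat {V : nmodType} (m : nat) (f : nat -> V) :
  \sum_(0 <= k < m.+1 | ~~ odd k) f k = \sum_(0 <= k < (m./2).+1) f (2 * k)%N.
Proof.
elim: m => [|m IHm]; first by rewrite big_mkcond !big_nat1.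
rewrite big_mkcond big_nat_recr //= -big_mkcond IHm uphalf_half.
case: (boolP (odd m)) => m_odd /=; last by rewrite addr0.
rewrite add1n [RHS]big_nat_recr //=; congr (_ + f _).
by rewrite -[in LHS](odd_double_half m) m_odd -mul2n mulnS.
Qed.

(** In the two binomial expansions the odd powers of [c] cancel and the even ones double. *)
Lemma exprDn_sym {R : comNzRingType} (x c : R) (m : nat) :
  (x + c) ^+ m + (x - c) ^+ m
  = \sum_(0 <= k < (m./2).+1)
      (c ^+ (2 * k) * x ^+ (m - 2 * k)) *+ 'C(m, 2 * k) *+ 2.
Proof.
rewrite !exprDn -big_split /=.
rewrite -(sum_even_nat m (fun k => (c ^+ k * x ^+ (m - k)) *+ 'C(m, k) *+ 2)).
rewrite [RHS]big_mkcond big_mkord; apply: eq_bigr => k _.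
rewrite exprNn -signr_odd; case: (odd k) => /=.
  by rewrite expr1 mulN1r mulrN mulNrn addrN.
by rewrite expr0 mul1r mulr2n [x ^+ _ * _]mulrC.
Qed.

Lemma umbral_sym {R : comNzRingType} (e : nat -> R) (c : R) (m : nat) :
  umbral e (('X + c%:P) ^+ m) + umbral e (('X - c%:P) ^+ m)
  = 2 * \sum_(0 <= k < (m./2).+1) 'C(m, 2 * k)%:R * c ^+ (2 * k) * e (m - 2 * k)%N.
Proof.
rewrite -raddfD exprDn_sym raddf_sum mulr_sumr; apply: eq_bigr => k _ /=.
rewrite !raddfMn /= -rmorphXn /= mul_polyC linearZ /= umbralXn.
by rewrite -[LHS]mulr_natl -[X in _ * X = _]mulr_natl !mulrA.
Qed.

(** By [umbral_sym] at [c = 1], the second summand is [a] times the full even binomial sum. Its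
    [k = 0] term [a * Enum a m] completes [(1 - a) * Enum a m] to [Enum a m], and for [m > 0] the
    recursion cancels the rest. *)
Lemma umbral_Enum_Xn {R : realType} (a : R) (m : nat) :
  (1 - a) * Enum a m
  + a / 2 * (umbral (Enum a) (('X + 1) ^+ m) + umbral (Enum a) (('X - 1) ^+ m))
  = (m == 0)%:R.
Proof.
rewrite -[X in 'X + X]polyC1 -[X in 'X - X]polyC1 umbral_sym.
under eq_bigr => k _ do rewrite expr1n mulr1.
rewrite big_nat_recl // muln0 bin0 subn0 mul1r.
case: m => [|m]; first by rewrite big_geq // Enum0 eqxx mulr1n; field.
have := @EnumS R a m.+1 isT; rewrite big_add1 /= => EaS.
set s := \sum_(0 <= i < _) _ in EaS *.
by rewrite EaS; field.
Qed.

(** Both sides are linear in [p], and [(m == 0)%:R] is the value of ['X^m] at 0. *)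
Lemma umbral_Enum {R : realType} (a : R) (p : {poly R}) :
  (1 - a) * umbral (Enum a) p
  + a / 2 * (umbral (Enum a) (p \Po ('X + 1)) + umbral (Enum a) (p \Po ('X - 1)))
  = p.[0].
Proof.
rewrite -[p]coefK poly_def horner_sum !raddf_sum -big_split /= !mulr_sumr.
rewrite -big_split; apply: eq_bigr => i _ /=.
rewrite !linearZ /= !comp_Xn_poly umbralXn hornerZ hornerXn expr0n.
by rewrite -(umbral_Enum_Xn a); ring.
Qed.

Lemma umbral_Enum_exp {R : realType} (a y : R) (m : nat) :
  let U z := umbral (Enum a) (('X + z%:P) ^+ m) in
  (1 - a) * U y + a / 2 * (U (y + 1) + U (y - 1)) = y ^+ m.
Proof.
move=> U; have := umbral_Enum a (('X + y%:P) ^+ m).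
rewrite !rmorphXn /= !rmorphD /= !comp_polyX !comp_polyC.
have -> : 'X + 1 + y%:P = 'X + (y + 1)%:P by rewrite polyCD polyC1; ring.
have -> : 'X - 1 + y%:P = 'X + (y - 1)%:P by rewrite polyCB polyC1; ring.
by rewrite horner_exp hornerD hornerX hornerC add0r.
Qed.

Lemma Enum_even_sum_rec {R : realType} (a y : R) (n : nat) :
  let S z := \sum_(0 <= k < n.+1)
    'C(2 * n, 2 * k)%:R * z ^+ (2 * k) * Enum a (2 * n - 2 * k) in
  (1 - a) * S y + a / 2 * (S (y + 1) + S (y - 1)) = y ^+ (2 * n).
Proof.
move=> S; pose U z := umbral (Enum a) (('X + z%:P) ^+ (2 * n)).
(* [S] is the even part of [U], so averaging the relations for [U] at [y] and [- y] gives the one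
   for [S]. *)
have SE z : S z = (U z + U (- z)) / 2.
  rewrite /U polyCN umbral_sym -/(S z) mul2n doubleK -mul2n -/(S z).
  by field.
have U1 := umbral_Enum_exp a y (2 * n).
have U2 := umbral_Enum_exp a (- y) (2 * n).
have Ny : (- y) ^+ (2 * n) = y ^+ (2 * n) by rewrite !exprM sqrrN.
rewrite /= -/(U _) -/(U _) in U1 U2.
(* Negation swaps the two shifts: [- (y + 1)] is [- y - 1] and [- (y - 1)] is [- y + 1]. *)
rewrite Ny in U2; rewrite !SE opprD opprB [1 - y]addrC.
rewrite -[RHS](_ : (y ^+ (2 * n) + y ^+ (2 * n)) / 2 = _); last by field.
by rewrite -{1}U1 -U2; field.
Qed.

Theorem theorem2p5 (R : realType) (a : R) (n : nat) (ha : a <> 0) (hn : (0 < n)%N) :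
  \sum_(1 <= k < n.+1) 'C(2 * n, 2 * k)%:R * 4 ^+ (2 * k) * Enum a (2 * n - 2 * k)
  = 2 * (3 ^+ (2 * n) - 1) / a
    + 8 * (a - 1) ^+ 2 / a ^+ 3
    + 2 ^+ (2 * n + 2) * (a - 1) / a ^+ 2
    - 8 * (a - 1) ^+ 2 * (2 * a - 1) / a ^+ 4 * Enum a (2 * n).
Proof.
have a0 : a != 0 by apply/eqP.
pose S (z : R) := \sum_(0 <= k < n.+1)
  'C(2 * n, 2 * k)%:R * z ^+ (2 * k) * Enum a (2 * n - 2 * k).
(* The relation is solved for its leading value, which requires dividing by [a]. *)
have Srec y : S (y + 1) = 2 / a * (y ^+ (2 * n) - (1 - a) * S y) - S (y - 1).
  have : (1 - a) * S y + a / 2 * (S (y + 1) + S (y - 1)) = y ^+ (2 * n).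
    exact: Enum_even_sum_rec.
  by move=> <-; field.
have S_tail z : S z = Enum a (2 * n)
    + \sum_(1 <= k < n.+1) 'C(2 * n, 2 * k)%:R * z ^+ (2 * k) * Enum a (2 * n - 2 * k).
  by rewrite /S big_ltn // muln0 bin0 expr0 subn0 !mul1r.
(* Only [k = 0] survives, because [0 ^+ 0 = 1]. *)
have S0 : S 0 = Enum a (2 * n).
  rewrite S_tail big_nat big1 ?addr0 // => k /andP[k_gt0 _].
  by rewrite expr0n muln_eq0 /= eqn0Ngt k_gt0 mulr0 mul0r.
have SN z : S (- z) = S z.
  by apply: eq_bigr => k _; rewrite !exprM sqrrN.
have S1 : S 1 = - ((1 - a) / a) * Enum a (2 * n).
  (* At [y = 0], evenness makes [S 1] occur on both sides, and [0 ^+ (2 * n)] vanishes since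
     [n > 0]. Replacing one of two copies of [S 1] then cancels the other. *)
  have := Srec 0; rewrite add0r sub0r SN S0 expr0n muln_eq0 /= eqn0Ngt hn => S1E.
  have -> : S 1 = (S 1 + S 1) / 2 by field.
  by rewrite {1}S1E mulr0n; field.
have Sstep x y z : x + 1 = y -> y + 1 = z ->
    S z = 2 / a * (y ^+ (2 * n) - (1 - a) * S y) - S x.
  by move=> <- <-; rewrite Srec addrK.
have S2 : S 2 = 2 / a * (1 - (1 - a) * S 1) - S 0.
  by rewrite (Sstep 0 1) ?expr1n //; ring.
have S3 : S 3 = 2 / a * (2 ^+ (2 * n) - (1 - a) * S 2) - S 1.
  by apply: Sstep; ring.
have S4 : S 4 = 2 / a * (3 ^+ (2 * n) - (1 - a) * S 3) - S 2.
  by apply: Sstep; ring.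
(* The sum in the goal lacks the [k = 0] term of [S 4]; adding [Enum a (2 * n)] to both sides
   restores it. *)
apply: (addrI (Enum a (2 * n))); rewrite -S_tail S4 S3 S2 S1 S0 exprD.
(* With these three values as free variables, a rational identity in [a] remains. *)
move: (2 ^+ (2 * n)) (3 ^+ (2 * n)) (Enum a (2 * n)) => x y e.
by field.
Qed.
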